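(* Let $PG(r-1,q)$ be the rank-$r$ projective geometry over the finite field $GF(q)$, where $r$ is a positive integer and $q$ is a prime power. Let $C_3(PG(r-1,q))$ be the hypergraph whose vertices are the points of $PG(r-1,q)$ and whose hyperedges are the $3$-element circuits of the matroid $PG(r-1,q)$. Then $hc(C_3(PG(r-1,q)))=r+1$.
   Context: $PG(r-1,q)$ is viewed as the rank-$r$ simple matroid whose elements are the one-dimensional subspaces of $GF(q)^r$, with independence given by linear independence; its $3$-circuits are the sets of three distinct collinear points. For an integer $t\ge 1$, a $t$-colouring of a hypergraph $H=(V,E)$ is a surjective function $\phi:V\to\{1,\dots,t\}$ (all colours must be used). A $t$-colouring $\phi$ is heterochromatic if there is a hyperedge $e\in E$ whose vertices receive pairwise distinct colours under $\phi$ (a totally multicoloured hyperedge). The heterochromatic number $hc(H)$ is the minimum $t\ge 1$ such that every $t$-colouring of $H$ is heterochromatic. *)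

(* Defs.v *)
From HB Require Import structures.
From mathcomp Require Import all_boot all_order all_algebra.

Set Implicit Arguments.
Unset Strict Implicit.
Unset Printing Implicit Defensive.

Record matroid (T : finType) := Matroid {
  indep : pred {set T};
  indep0 : indep set0;
  indepS : forall A B : {set T}, A \subset B -> indep B -> indep A;
  indep_aug : forall A B : {set T}, indep A -> indep B -> #|A| < #|B| ->
    exists2 x, x \in B :\: A & indep (x |: A)
}.

Definition circuit (T : finType) (M : matroid T) (C : {set T}) : bool :=
  minset (fun A => ~~ indep M A) C.

Record hypergraph := Hypergraph {
  vertex : finType;
  edges : {set {set vertex}}
}.

(* The colours 1, ..., t are represented by 'I_t = {0, ..., t - 1}. *)
Definition colouring (H : hypergraph) (t : nat)
    (phi : {ffun vertex H -> 'I_t}) : bool :=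
  [forall c, exists v, phi v == c].

Definition heterochromatic (H : hypergraph) (t : nat)
    (phi : {ffun vertex H -> 'I_t}) : bool :=
  [exists e in edges H, dinjectiveb phi e].

Definition all_heterochromatic (H : hypergraph) (t : nat) : bool :=
  [forall phi : {ffun vertex H -> 'I_t},
     colouring phi ==> heterochromatic phi].

(* For t = #|V| + 1 there is no surjective colouring at all. *)
Lemma hc_exists (H : hypergraph) :
  exists t, (0 < t) && all_heterochromatic H t.
Proof.
exists #|vertex H|.+1; apply/forallP => phi; apply/implyP => /forallP phi_surj.
have: #|'I_#|vertex H|.+1| <= #|codom phi|.
  apply/subset_leq_card/subsetP => c _.
  by have /existsP[v /eqP<-] := phi_surj c; apply: codom_f.
rewrite card_ord => /leq_trans/(_ (leq_image_card _ _)).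
by rewrite ltnn.
Qed.

Definition hc (H : hypergraph) : nat := ex_minn (hc_exists H).

Definition C3 (T : finType) (M : matroid T) : hypergraph :=
  @Hypergraph T [set C : {set T} | circuit M C & #|C| == 3].

(* Makes visible that {vspace vT} is a subtype of a matrix type. *)
Import VectorInternalTheory.

HB.instance Definition _ (F : finFieldType) (vT : vectType F) :=
  [Countable of {vspace vT} by <:].
HB.instance Definition _ (F : finFieldType) (vT : vectType F) :=
  [Finite of {vspace vT} by <:].

Definition pg_point (F : finFieldType) (r : nat) : finType :=
  {U : {vspace 'rV[F]_r} | \dim U == 1}.

(* vpick selects a nonzero vector of the line p; whether the selected vectors
   are linearly independent does not depend on the selection. *)
Definition pg_indep (F : finFieldType) (r : nat) : pred {set pg_point F r} :=
  fun A => free [seq vpick (val p) | p <- enum A].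

Lemma pg_indep0 (F : finFieldType) (r : nat) : @pg_indep F r set0.
Proof. by rewrite /pg_indep enum_set0 /= nil_free. Qed.

Lemma pg_indepS (F : finFieldType) (r : nat) (A B : {set pg_point F r}) :
  A \subset B -> pg_indep B -> pg_indep A.
Proof.
move=> sAB; rewrite /pg_indep.
have eqB : perm_eq (enum B) (enum A ++ enum (B :\: A)).
  apply: uniq_perm; rewrite ?enum_uniq // ?cat_uniq ?enum_uniq ?andbT /=.
    by apply/hasPn => p; rewrite /= !mem_enum inE => /andP[].
  move=> p; rewrite mem_cat !mem_enum inE.
  by case: (boolP (p \in A)) => //= /(subsetP sAB).
by rewrite (perm_free (perm_map _ eqB)) map_cat; apply: catl_free.
Qed.

Lemma pg_indep_aug (F : finFieldType) (r : nat) (A B : {set pg_point F r}) :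
  pg_indep A -> pg_indep B -> #|A| < #|B| ->
  exists2 x, x \in B :\: A & pg_indep (x |: A).
Proof.
move=> freeA freeB ltAB; apply/exists_inP; apply: contraLR ltAB => /exists_inPn noAug.
rewrite -leqNgt !cardE -!(size_map (fun p => vpick (val p))).
move: (freeA) (freeB); rewrite /pg_indep /free => /eqP <- /eqP <-.
apply: dimvS; apply/span_subvP => v /mapP[p]; rewrite mem_enum => pB ->.
case: (boolP (p \in A)) => pA.
  by apply/memv_span/map_f; rewrite mem_enum.
have pBA : p \in B :\: A by rewrite inE pA.
have := noAug p pBA; rewrite /pg_indep.
have eqpA : perm_eq (enum (p |: A)) (p :: enum A).
  apply: uniq_perm; rewrite /= ?enum_uniq ?mem_enum ?pA // => x.
  by rewrite inE !mem_enum !inE.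
rewrite (perm_free (perm_map _ eqpA)) /= free_cons negb_and negbK.
by rewrite [free _]freeA orbF.
Qed.

(* The matroid PG(r-1, q), where F = GF(q). *)
Definition PG (r : nat) (F : finFieldType) : matroid (pg_point F r) :=
  Matroid (@pg_indep0 F r) (@pg_indepS F r) (@pg_indep_aug F r).

(* Main.v *)
Require Import Defs.
From mathcomp Require Import all_boot all_order all_algebra.

Set Implicit Arguments.
Unset Strict Implicit.
Unset Printing Implicit Defensive.

Import GRing.Theory.
Local Open Scope ring_scope.

(** A colouring of the points of PG(r-1, q) is the same thing as a colouring of
the nonzero vectors of GF(q)^r that is constant on lines through the origin.
Such a colouring has no rainbow (totally multicoloured) 3-circuit exactly when
the sum of two vectors of different colours always takes one of their two
colours. This condition propagates from two vectors to many: every nonzero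
vector in the span of nonzero vectors of pairwise different colours has the
colour of one of them ([rainbow_span]). Consequently nonzero vectors of pairwise
different colours are linearly independent ([rainbow_free]).

Both bounds follow from this. If [r + 1] colours are used and no 3-circuit is
rainbow, then one point of each colour gives [r + 1] independent vectors
in a space of dimension [r], which is absurd. For [0 < t <= r], give to a vector
the position of its first nonzero coordinate, merging all positions from [t - 1]
on into one colour. All [t] colours occur on the standard basis. The position of
the first nonzero coordinate satisfies the condition on sums, so points of
pairwise different colours are independent, and no circuit, whatever its size,
is rainbow. *)

(** * Vector colourings without rainbow lines *)

(** A colouring of points seen on vectors: only nonzero vectors span a point. *)
Definition no_rainbow_line (K : fieldType) (V : vectType K) (C : eqType)
    (c : V -> C) : Prop :=
  (forall a v, a != 0 -> v != 0 -> c (a *: v) = c v) /\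
  (forall u v, u != 0 -> v != 0 -> c u != c v -> c (u + v) \in [:: c u; c v]).

Section NoRainbowLine.

Variables (K : fieldType) (V : vectType K) (C : eqType) (c : V -> C).
Hypothesis c_nrl : no_rainbow_line c.

(** Write a vector of the span as [a *: x + w], with [w] in the span of the
vectors other than [x]. By induction [w] has the colour of one of these, hence
not the colour of [x], and the condition on sums applies. *)
Lemma rainbow_span (s : seq V) (v : V) :
  0 \notin s -> uniq (map c s) -> v \in <<s>>%VS -> v != 0 -> c v \in map c s.
Proof.
case: c_nrl => cZ cD.
elim: s v => [|x s IHs] v; first by rewrite span_nil memv0 => _ _ ->.
rewrite in_cons [0 == x]eq_sym map_cons => /norP[x0 s0] /andP[xs us].
rewrite span_cons => /memv_addP[_ /vlineP[a ->] [w ws ->]].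
have [->|a0] := eqVneq a 0.
  by rewrite scale0r add0r => w0; rewrite inE IHs ?orbT.
have [->|w0] := eqVneq w 0; first by rewrite addr0 cZ // mem_head.
have cw := IHs w s0 us ws w0.
have cxw : c (a *: x) != c w by rewrite cZ //; apply: contraNneq xs => ->.
have ax0 : a *: x != 0 by rewrite scaler_eq0 negb_or a0.
have := cD _ _ ax0 w0 cxw; rewrite cZ // !inE => /orP[->//|/eqP-> _].
by rewrite cw orbT.
Qed.

Lemma rainbow_free (s : seq V) :
  0 \notin s -> uniq (map c s) -> free s.
Proof.
elim: s => [|x s IHs]; first by rewrite nil_free.
rewrite in_cons [0 == x]eq_sym map_cons => /norP[x0 s0] /andP[xs us].
rewrite free_cons IHs // andbT; apply: contra xs => x_s.
exact: rainbow_span.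
Qed.

End NoRainbowLine.

(** * The position of the first nonzero coordinate *)

Section Pivot.

Variables (K : fieldType) (r : nat).
Implicit Types u v : 'rV[K]_r.

Definition pivot v : nat := find (fun i => v 0 i != 0) (enum 'I_r).

Lemma pivotP v :
  v != 0 -> exists i : 'I_r,
    [/\ pivot v = i, v 0 i != 0 & forall j : 'I_r, (j < i)%N -> v 0 j = 0].
Proof.
move=> /rV0Pn[k vk].
have has_v : has (fun i => v 0 i != 0) (enum 'I_r).
  by apply/hasP; exists k; rewrite ?mem_enum.
have := has_v; rewrite has_find size_enum_ord -/(pivot v) => ltv.
exists (Ordinal ltv); split=> // [|j ltj].
  by have := nth_find k has_v; rewrite -/(pivot v) -[pivot v]/(val (Ordinal ltv))
    nth_ord_enum.
by have /negbFE/eqP := before_find k ltj; rewrite nth_ord_enum.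
Qed.

Lemma pivot_unique v (i : 'I_r) :
  v 0 i != 0 -> (forall j : 'I_r, (j < i)%N -> v 0 j = 0) -> pivot v = i.
Proof.
move=> vi v0; have vn0 : v != 0 by apply/rV0Pn; exists i.
have [k [-> vk v0k]] := pivotP vn0.
case: (ltngtP k i) => // [/v0|/v0k] /eqP; first by rewrite (negPf vk).
by rewrite (negPf vi).
Qed.

Lemma pivotZ a v : a != 0 -> pivot (a *: v) = pivot v.
Proof. by move=> a0; apply: eq_find => i; rewrite mxE mulf_eq0 (negPf a0). Qed.

Lemma pivotD u v :
  u != 0 -> v != 0 -> (pivot u < pivot v)%N -> pivot (u + v) = pivot u.
Proof.
move=> /pivotP[i [-> ui u0]] /pivotP[k [-> _ v0]] ltik.
apply: pivot_unique => [|j ltji]; first by rewrite mxE v0 ?addr0.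
by rewrite mxE u0 // v0 ?addr0 // (ltn_trans ltji).
Qed.

Lemma pivot_no_rainbow_line : no_rainbow_line pivot.
Proof.
split=> [a v a0 _|u v u0 v0]; first exact: pivotZ.
case: ltngtP => // lt _; first by rewrite pivotD // mem_head.
by rewrite addrC pivotD // !inE eqxx orbT.
Qed.

End Pivot.

(** * Points and their representative vectors *)

Lemma card_set_seq (T : finType) (s : seq T) :
  uniq s -> #|[set x in s]| = size s.
Proof. by rewrite cardsE => /card_uniqP. Qed.

Lemma uniq_map_inj_in (T C : eqType) (f : T -> C) (s : seq T) :
  uniq (map f s) -> {in s &, injective f}.
Proof.
elim: s => // x s IHs; rewrite map_cons => /andP[xs us] y z.
rewrite !inE => /predU1P[->|ys] /predU1P[->|zs] // eyz; last exact: IHs.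
  by rewrite eyz map_f in xs.
by rewrite -eyz map_f in xs.
Qed.

Section Points.

Variables (F : finFieldType) (r : nat).
Implicit Types (p q : pg_point F r) (A : {set pg_point F r}).

Definition pvec p : 'rV[F]_r := vpick (val p).

Lemma pvec_neq0 p : pvec p != 0.
Proof. by rewrite vpick0 -dimv_eq0 (eqP (valP p)). Qed.

Lemma line_pvec p : <[pvec p]>%VS = val p.
Proof.
apply/eqP; rewrite eqEdim -memvE memv_pick (eqP (valP p)).
by rewrite dim_vline pvec_neq0.
Qed.

Lemma zero_notin_pvec (s : seq (pg_point F r)) : 0 \notin map pvec s.
Proof.
by apply/mapP => -[p _ /esym/eqP]; rewrite (negPf (pvec_neq0 p)).
Qed.

(** The default [p0] is returned at [v = 0] only. *)
Definition point_of (p0 : pg_point F r) (v : 'rV[F]_r) : pg_point F r :=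
  insubd p0 <[v]>%VS.

Lemma val_point_of p0 v : v != 0 -> val (point_of p0 v) = <[v]>%VS.
Proof. by move=> v0; rewrite val_insubd dim_vline v0. Qed.

Lemma pvecK p0 : cancel pvec (point_of p0).
Proof.
by move=> p; apply: val_inj; rewrite val_point_of ?pvec_neq0 ?line_pvec.
Qed.

Lemma point_ofZ p0 a v :
  a != 0 -> v != 0 -> point_of p0 (a *: v) = point_of p0 v.
Proof.
move=> a0 v0; have av0 : a *: v != 0 by rewrite scaler_eq0 negb_or a0.
apply: val_inj; rewrite !val_point_of //; apply/eqP.
by rewrite eqEdim -memvE memvZ ?memv_line // !dim_vline v0 av0.
Qed.

Lemma pg_indep_card (U : {vspace 'rV[F]_r}) A :
  {in A, forall p, (val p <= U)%VS} -> pg_indep A -> (#|A| <= \dim U)%N.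
Proof.
move=> AU; rewrite /pg_indep /free => /eqP; rewrite size_map -cardE => <-.
apply/dimvS/span_subvP => _ /mapP[p pA ->].
by apply: (subvP (AU p _)); rewrite ?memv_pick // -mem_enum.
Qed.

(** Distinct points are distinct lines through the origin, so the matroid is
simple. *)
Lemma pg_indep_le2 A : (#|A| <= 2)%N -> pg_indep A.
Proof.
rewrite /pg_indep cardE.
case: (enum A) (enum_uniq A) => [|p [|q []]] //= uA _.
- exact: nil_free.
- by rewrite seq1_free pvec_neq0.
rewrite free_cons seq1_free pvec_neq0 andbT span_seq1 -/(pvec p) -/(pvec q).
move: uA; rewrite inE andbT; apply: contra => pq; apply/eqP/val_inj/eqP.
by rewrite -line_pvec -[val q]line_pvec eqEdim -memvE pq !dim_vline !pvec_neq0.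
Qed.

Lemma collinear_circuit (U : {vspace 'rV[F]_r}) A :
  (\dim U <= 2)%N -> #|A| = 3%N -> {in A, forall p, (val p <= U)%VS} ->
  circuit (PG r F) A.
Proof.
move=> dimU A3 AU; apply/minsetP; split=> [|B depB BA].
  by apply: contraL dimU => /(pg_indep_card AU); rewrite A3 -ltnNge.
apply/eqP; rewrite eqEcard BA A3 ltnNge.
by apply: contra depB; apply: pg_indep_le2.
Qed.

(** If [u], [v] and [u + v] had three different colours, then [<[u]>], [<[v]>]
and [<[u + v]>] would be three distinct points on the projective line
[<[u]> + <[v]>], hence a rainbow circuit. *)
Lemma point_colour_no_rainbow_line (t : nat)
    (phi : {ffun vertex (C3 (PG r F)) -> 'I_t}) (p0 : pg_point F r) :
  ~~ heterochromatic phi -> no_rainbow_line (fun v => phi (point_of p0 v)).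
Proof.
move=> nhet; split=> [a v a0 v0|u v u0 v0 cuv]; first by rewrite point_ofZ.
have uv0 : u + v != 0.
  apply: contraNneq cuv => /eqP; rewrite addr_eq0 => /eqP->.
  by rewrite -scaleN1r point_ofZ // oppr_eq0 oner_eq0.
apply: contraR nhet; rewrite !inE => /norP[cu cv].
set p := point_of p0 u in cuv cu; set q := point_of p0 v in cuv cv.
set w := point_of p0 (u + v) in cu cv.
pose s : seq (pg_point F r) := [:: p; q; w]; pose A := [set x in s].
have us : uniq (map phi s).
  by rewrite /= !inE negb_or cuv ![phi _ == phi w]eq_sym cu cv.
have A3 : #|A| = 3%N := card_set_seq (map_uniq us).
apply/exists_inP; exists A.
  rewrite inE A3 eqxx andbT.
  apply: (@collinear_circuit (<[u]> + <[v]>)%VS) => // [|x].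
    by apply: leq_trans (dimv_add_leqif _ _) _; rewrite !dim_vline u0 v0.
  rewrite !inE => /or3P[] /eqP->; rewrite val_point_of // ?addvSl ?addvSr //.
  by rewrite -memvE memv_add ?memv_line.
apply/dinjectiveP => x y; rewrite [x \in A]inE [y \in A]inE.
exact: (uniq_map_inj_in us).
Qed.

End Points.

(** * The two bounds *)

Lemma colours_le_rank (r : nat) (F : finFieldType) (t : nat)
    (phi : {ffun vertex (C3 (PG r F)) -> 'I_t}) :
  colouring phi -> ~~ heterochromatic phi -> (t <= r)%N.
Proof.
case: t phi => // t phi /forallP surj nhet.
pose rep c := xchoose (existsP (surj c)).
have repE c : phi (rep c) = c by apply/eqP/(xchooseP (existsP (surj c))).
pose s := map (@pvec F r) (map rep (enum 'I_t.+1)).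
have nd := point_colour_no_rainbow_line (rep ord0) nhet.
have /eqP sfree : free s.
  apply: (rainbow_free nd); first exact: zero_notin_pvec.
  rewrite -2!map_comp; set f := (f in map f _).
  have fE : f =1 id by move=> c; rewrite /f /= pvecK repE.
  by rewrite (eq_map fE) map_id enum_uniq.
have := dimvS (subvf <<s>>%VS).
by rewrite sfree dimvf 2!size_map size_enum_ord dim_matrix mul1r.
Qed.

Lemma non_heterochromatic_colouring (r : nat) (F : finFieldType) (t : nat) :
  (0 < t)%N -> (t <= r)%N ->
  exists2 phi : {ffun vertex (C3 (PG r F)) -> 'I_t},
    colouring phi & ~~ heterochromatic phi.
Proof.
case: t => // k _ ltkr.
pose phi : {ffun vertex (C3 (PG r F)) -> 'I_k.+1} :=
  [ffun p => inord (minn (pivot (pvec p)) k)].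
exists phi.
  apply/forallP => c; apply/existsP.
  pose i : 'I_r := widen_ord ltkr c; pose e : 'rV[F]_r := delta_mx 0 i.
  have ei : e 0 i != 0 by rewrite mxE !eqxx oner_eq0.
  have e0 : e != 0 by apply/rV0Pn; exists i.
  have e_line : \dim <[e]>%VS == 1%N by rewrite dim_vline e0.
  pose p : pg_point F r := Sub <[e]>%VS e_line.
  exists p; rewrite ffunE.
  have /vlineP[a pa] : pvec p \in <[e]>%VS by exact: memv_pick.
  have a0 : a != 0.
    by have := pvec_neq0 p; rewrite pa scaler_eq0 negb_or => /andP[].
  have pe : pivot e = i.
    apply: pivot_unique => // j ltji; rewrite mxE eqxx /=.
    by case: eqP ltji => // ->; rewrite ltnn.
  apply/eqP/val_inj; rewrite pa pivotZ // pe /= (minn_idPl _) ?inord_val //.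
  exact: ltn_ord c.
(* Merging positions only removes differences, so points of different colours
   have different pivots. *)
apply/exists_inPn => A; rewrite inE => /andP[/minsetP[depA _] _].
apply: contra depA => /dinjectiveP injA.
apply: (rainbow_free (@pivot_no_rainbow_line F r)).
  exact: zero_notin_pvec.
rewrite -map_comp map_inj_in_uniq ?enum_uniq // => p q.
rewrite !mem_enum => pA qA /= epq; apply: injA => //.
by rewrite !ffunE /pvec epq.
Qed.

Local Close Scope ring_scope.

Theorem theorem4p2 (r : nat) (F : finFieldType) (r_gt0 : 0 < r) :
  hc (C3 (PG r F)) = r.+1.
Proof.
rewrite /hc; case: ex_minnP => t /andP[t0 /forallP het] t_min.
apply/eqP; rewrite eqn_leq t_min /=.
  rewrite ltnNge; apply/negP => tr.
  have [phi col] := non_heterochromatic_colouring F t0 tr.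
  by rewrite (implyP (het phi) col).
apply/forallP => phi; apply/implyP => col.
by apply/contraT => /(colours_le_rank col); rewrite ltnn.
Qed.
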